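(* Let $(X,\mathcal U)$ be a quasi-uniform $T_0$-space and $(\widetilde X,\widetilde{\mathcal U})$ its bicompletion. Then $(\mathcal P_0(\widetilde X),\widetilde{\mathcal U}_H)$ is bicomplete if and only if each doubly stable filter on $(X,\mathcal U)$ is $\mathcal U_D$-equivalent to the intersection of a nonempty family of $\mathcal U^s$-Cauchy filters on $(X,\mathcal U)$.
   Context: A quasi-uniformity on $X$ is a filter $\mathcal U$ on $X\times X$ whose members all contain the diagonal and such that each $U\in\mathcal U$ admits $V\in\mathcal U$ with $V\circ V\subseteq U$. Write $U(x)=\{y:(x,y)\in U\}$, $U(A)=\bigcup_{x\in A}U(x)$; $\tau(\mathcal U)$ is the topology in which $\{U(x):U\in\mathcal U\}$ is the neighborhood filter of $x$. $\mathcal U^{-1}=\{U^{-1}:U\in\mathcal U\}$ and $\mathcal U^s$ is the coarsest uniformity finer than $\mathcal U$ (generated by $U\cap U^{-1}$, $U\in\mathcal U$). $(X,\mathcal U)$ is bicomplete if $\mathcal U^s$ is complete, and is a $T_0$-space if $\tau(\mathcal U)$ is $T_0$. The bicompletion $(\widetilde X,\widetilde{\mathcal U})$ of a quasi-uniform $T_0$-space $(X,\mathcal U)$ is the (unique up to quasi-uniform isomorphism) bicomplete quasi-uniform $T_0$-space containing $(X,\mathcal U)$ as a $\tau(\widetilde{\mathcal U}^s)$-dense quasi-uniform subspace. For a quasi-uniform space $(Y,\mathcal V)$, $\mathcal P_0(Y)$ is the set of nonempty subsets of $Y$ and the Hausdorff quasi-uniformity $\mathcal V_H$ on $\mathcal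 P_0(Y)$ has base $\{V_H:V\in\mathcal V\}$, $V_H=\{(A,B):B\subseteq V(A),\ A\subseteq V^{-1}(B)\}$. A filter $\mathcal F$ on $X$ is doubly stable on $(X,\mathcal U)$ if for each $U\in\mathcal U$ the set $\bigcap_{F\in\mathcal F}(U^{-1}(F)\cap U(F))$ belongs to $\mathcal F$ (every intersection of a nonempty family of $\mathcal U^s$-Cauchy filters is doubly stable). $S_D(X)$ is the set of doubly stable filters. For $U\in\mathcal U$ let $U_D=\{(\mathcal F,\mathcal G)\in S_D(X)^2:\bigcap_{F\in\mathcal F}U(F)\in\mathcal G\text{ and }\bigcap_{G\in\mathcal G}U^{-1}(G)\in\mathcal F\}$; the sets $U_D$ form a base of a quasi-uniformity $\mathcal U_D$ on $S_D(X)$. Two doubly stable filters $\mathcal F,\mathcal G$ are $\mathcal U_D$-equivalent if both $(\mathcal F,\mathcal G)$ and $(\mathcal G,\mathcal F)$ belong to $\bigcap\mathcal U_D$. *)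

(* Defs.v *)
From HB Require Import structures.
From mathcomp Require Import all_boot all_classical topology.

Set Implicit Arguments.
Unset Strict Implicit.
Unset Printing Implicit Defensive.

Local Open Scope classical_set_scope.
Local Open Scope relation_scope.

(* As with [entourage] in [uniformType], [qentourage] is only required to be a
   [Filter]: it is automatically proper on a nonempty carrier, and the empty
   quasi-uniform space is allowed.  The [nbhs] of the underlying topology is
   tau(U): the filter at x has base U(x) = [xsection U x]. *)
HB.mixin Record Nbhs_isQuasiUniform_mixin M & Nbhs M := {
  qentourage : set_system (M * M);
  qentourage_filter : Filter qentourage;
  qentourage_diagonal : forall U, qentourage U -> diagonal `<=` U;
  qentourage_split_ex :
    forall U, qentourage U -> exists2 V, qentourage V & V \; V `<=` U;
  nbhs_qentourageE : nbhs = nbhs_ qentourage;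
}.

#[short(type="quasiUniformType")]
HB.structure Definition QuasiUniform :=
  {T of Topological T & Nbhs_isQuasiUniform_mixin T}.

HB.factory Record isQuasiUniform M & Choice M := {
  qentourage : set_system (M * M);
  qentourage_filter : Filter qentourage;
  qentourage_diagonal : forall U, qentourage U -> diagonal `<=` U;
  qentourage_split_ex :
    forall U, qentourage U -> exists2 V, qentourage V & V \; V `<=` U;
}.

HB.builders Context M & isQuasiUniform M.

HB.instance Definition _ := @hasNbhs.Build M (nbhs_ qentourage).

Let nbhs_filter (p : M) : ProperFilter (nbhs p).
Proof.
apply: filter_from_proper; last first.
  by move=> A entA; exists p; apply/mem_set; apply: qentourage_diagonal entA _ _.
apply: filter_from_filter.
  by exists setT; exact: @filterT qentourage_filter.
move=> A B entA entB; exists (A `&` B); last by rewrite xsectionI.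
exact: (@filterI _ _ qentourage_filter).
Qed.

Let nbhs_singleton (p : M) A : nbhs p A -> A p.
Proof.
by move=> [B entB]; apply; apply/mem_set; exact: qentourage_diagonal entB _ _.
Qed.

Let nbhs_nbhs (p : M) A : nbhs p A -> nbhs p (nbhs^~ A).
Proof.
move=> [B entB sBpA]; have /qentourage_split_ex[C entC sC2B] := entB.
exists C => // q Cpq; exists C => // r Cqr.
by apply/sBpA/mem_set/sC2B; exists q; exact/set_mem.
Qed.

HB.instance Definition _ := Nbhs_isNbhsTopological.Build M
  nbhs_filter nbhs_singleton nbhs_nbhs.

HB.instance Definition _ := Nbhs_isQuasiUniform_mixin.Build M
  qentourage_filter qentourage_diagonal qentourage_split_ex erefl.

HB.end.

#[export] Existing Instance qentourage_filter.

Definition ent_image {T : Type} (U : set (T * T)) (A : set T) : set T :=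
  \bigcup_(x in A) xsection U x.

Lemma ent_imageP {T : Type} (U : set (T * T)) (A : set T) y :
  ent_image U A y <-> exists2 x, A x & U (x, y).
Proof.
by split=> -[x Ax] => [/xsectionP|] Uxy; exists x => //; exact/xsectionP.
Qed.

Lemma ent_imageS {T : Type} (U V : set (T * T)) (A B : set T) :
  U `<=` V -> A `<=` B -> ent_image U A `<=` ent_image V B.
Proof.
move=> UV AB y /ent_imageP[x Ax Uxy]; apply/ent_imageP.
by exists x; [exact: AB | exact: UV].
Qed.

(* An alias, so that tau(U) stays on X and the uniform topology tau(U^s) lives on
   [symmetrized X]. *)
Definition symmetrized (X : quasiUniformType) : Type := X.

Section symmetrized.
Variable X : quasiUniformType.

HB.instance Definition _ := Choice.on (symmetrized X).

Let sym_ent : set_system (symmetrized X * symmetrized X) :=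
  filter_from (@qentourage X) (fun U => U `&` U^-1).

Let sym_ent_filter : Filter sym_ent.
Proof.
apply: filter_from_filter; first by exists setT; exact: filterT.
move=> U V entU entV; exists (U `&` V); first exact: filterI.
by move=> xy [[? ?] [? ?]]; do 2!split.
Qed.

Let sym_ent_diagonal A : sym_ent A -> diagonal `<=` A.
Proof.
move=> [U entU UA] [x y] /diagonalP xy; apply: UA => /=.
by split; apply: (qentourage_diagonal _ entU); apply/diagonalP.
Qed.

Let sym_ent_inv A : sym_ent A -> sym_ent A^-1.
Proof. by move=> [U entU UA]; exists U => // -[x y] [? ?]; apply: UA. Qed.

Let sym_ent_split A :
  sym_ent A -> exists2 B, sym_ent B & B \; B `<=` A.
Proof.
move=> [U entU UA]; have [V entV VU] := qentourage_split_ex _ entU.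
exists (V `&` V^-1); first by exists V.
by move=> [x y] [z [? ?] [? ?]]; apply: UA; split; apply: VU; exists z.
Qed.

HB.instance Definition _ := isUniform.Build (symmetrized X)
  sym_ent_filter sym_ent_diagonal sym_ent_inv sym_ent_split.

End symmetrized.

(* The library's [completeType] demands a base point, which the empty space
   lacks; this is its axiom without that requirement. *)
Definition bicomplete (X : quasiUniformType) : Prop :=
  forall F : set_system (symmetrized X), ProperFilter F -> cauchy F ->
    exists x : symmetrized X, F --> x.

Record is_bicompletion (X Y : quasiUniformType) (i : X -> Y) : Prop := {
  bicompletion_inj : injective i;
  bicompletion_qentourage :
    @qentourage X =
    filter_from (@qentourage Y) (fun V => (fun xy => (i xy.1, i xy.2)) @^-1` V);
  bicompletion_dense : @dense (symmetrized Y) (range i);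
  bicompletion_bicomplete : bicomplete Y;
  bicompletion_T0 : kolmogorov_space Y
}.

Record hyperspace (Y : Type) := Hyperspace {
  hyper_set :> set Y;
  hyper_set_neq0 : hyper_set !=set0
}.

Section hausdorff_quasi_uniformity.
Variable Y : quasiUniformType.

HB.instance Definition _ := gen_eqMixin (hyperspace Y).
HB.instance Definition _ := gen_choiceMixin (hyperspace Y).

Definition hausdorff_ent (V : set (Y * Y)) :
    set (hyperspace Y * hyperspace Y) :=
  [set AB : hyperspace Y * hyperspace Y |
    AB.2 `<=` ent_image V AB.1 /\ AB.1 `<=` ent_image V^-1 AB.2].

Let hyper_ent : set_system (hyperspace Y * hyperspace Y) :=
  filter_from (@qentourage Y) hausdorff_ent.

Let hyper_ent_filter : Filter hyper_ent.
Proof.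
apply: filter_from_filter; first by exists setT; exact: filterT.
move=> U V entU entV; exists (U `&` V); first exact: filterI.
move=> [A B] [/= BA AB]; do 2!split => /=.
- by apply: subset_trans BA _; apply: ent_imageS => // ? [].
- by apply: subset_trans AB _; apply: ent_imageS => // ? [].
- by apply: subset_trans BA _; apply: ent_imageS => // ? [].
- by apply: subset_trans AB _; apply: ent_imageS => // ? [].
Qed.

Let hyper_ent_diagonal W : hyper_ent W -> diagonal `<=` W.
Proof.
move=> [V entV VW] [A B] /diagonalP AB; apply: VW; rewrite -{}AB.
by split=> x Ax; apply/ent_imageP; exists x => //;
  apply: (qentourage_diagonal _ entV); exact/diagonalP.
Qed.

Let hyper_ent_split W :
  hyper_ent W -> exists2 Z, hyper_ent Z & Z \; Z `<=` W.
Proof.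
move=> [U entU UW]; have [V entV VU] := qentourage_split_ex _ entU.
exists (hausdorff_ent V); first by exists V.
move=> [A B] [C /= [CA AC] [BC CB]]; apply: UW; split=> x /=.
  move=> /BC/ent_imageP[y /CA/ent_imageP[z Az Vzy] Vyx].
  by apply/ent_imageP; exists z => //; apply: VU; exists y.
move=> /AC/ent_imageP[y /CB/ent_imageP[z Bz Vzy] Vyx].
by apply/ent_imageP; exists z => //; apply: VU; exists y.
Qed.

HB.instance Definition _ := isQuasiUniform.Build (hyperspace Y)
  hyper_ent_filter hyper_ent_diagonal hyper_ent_split.

End hausdorff_quasi_uniformity.

Definition doubly_stable (X : quasiUniformType) (F : set_system X) : Prop :=
  forall U, qentourage U ->
    F (\bigcap_(A in F) (ent_image U^-1 A `&` ent_image U A)).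

Record ds_filter (X : quasiUniformType) := DsFilter {
  ds_sets :> set_system X;
  ds_proper : ProperFilter ds_sets;
  ds_doubly_stable : doubly_stable ds_sets
}.

#[export] Existing Instance ds_proper.

Section stability_quasi_uniformity.
Variable X : quasiUniformType.

HB.instance Definition _ := gen_eqMixin (ds_filter X).
HB.instance Definition _ := gen_choiceMixin (ds_filter X).

Definition ds_ent (U : set (X * X)) : set (ds_filter X * ds_filter X) :=
  [set FG | ds_sets FG.2 (\bigcap_(A in ds_sets FG.1) ent_image U A) /\
            ds_sets FG.1 (\bigcap_(B in ds_sets FG.2) ent_image U^-1 B)].

Let stab_ent : set_system (ds_filter X * ds_filter X) :=
  filter_from (@qentourage X) ds_ent.

Let ds_entS (U V : set (X * X)) : U `<=` V -> ds_ent U `<=` ds_ent V.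
Proof.
move=> UV [F G] [/= GU FU]; split=> /=.
  by apply: filterS GU => x xU A FA; apply: ent_imageS (xU _ FA).
by apply: filterS FU => x xU A FA; apply: ent_imageS (xU _ FA) => // ? /UV.
Qed.

Let stab_ent_filter : Filter stab_ent.
Proof.
apply: filter_from_filter; first by exists setT; exact: filterT.
move=> U V entU entV; exists (U `&` V); first exact: filterI.
by move=> FG FGUV; split; apply: ds_entS FGUV => ? [].
Qed.

Let stab_ent_diagonal W : stab_ent W -> diagonal `<=` W.
Proof.
move=> [U entU UW] [F G] /diagonalP FG; apply: UW; rewrite -{}FG.
have FU := ds_doubly_stable F entU.
by split=> /=; apply: filterS FU => x xU A /xU[].
Qed.

Let stab_ent_split W :
  stab_ent W -> exists2 Z, stab_ent Z & Z \; Z `<=` W.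
Proof.
move=> [U entU UW]; have [V entV VU] := qentourage_split_ex _ entU.
exists (ds_ent V); first by exists V.
move=> [F H] [G /= [GV FV] [HV GV']]; apply: UW; split=> /=.
  apply: filterS HV => x /(_ _ GV)/ent_imageP[y yV Vyx] A FA.
  have /ent_imageP[z Az Vzy] := yV _ FA.
  by apply/ent_imageP; exists z => //; apply: VU; exists y.
apply: filterS FV => x /(_ _ GV')/ent_imageP[y yV Vyx] A HA.
have /ent_imageP[z Az Vzy] := yV _ HA.
by apply/ent_imageP; exists z => //; apply: VU; exists y.
Qed.

HB.instance Definition _ := isQuasiUniform.Build (ds_filter X)
  stab_ent_filter stab_ent_diagonal stab_ent_split.

End stability_quasi_uniformity.

Definition ds_equivalent (X : quasiUniformType) (F G : ds_filter X) : Prop :=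
  (\bigcap_(W in qentourage) W) (F, G) /\ (\bigcap_(W in qentourage) W) (G, F).

Definition cauchy_intersection (X : quasiUniformType) (G : set_system X) :=
  exists C : set (set_system (symmetrized X)),
    [/\ C !=set0,
        forall H, C H -> ProperFilter H /\ cauchy H &
        G = \bigcap_(H in C) H].

(* Main.v *)
(* Let Y be the bicompletion of X, with X a subspace through i.
   If P_0(Y) is bicomplete and F is doubly stable on X, the sets i(B), with B in
   F and B contained in A, for A in F, generate a Cauchy filter on P_0(Y); it
   converges to some C, and F is equivalent to the intersection over c in C of
   the traces on X of the neighborhood filters of c, which are Cauchy by density.
   Conversely, the unions of the members of a Cauchy filter on P_0(Y), fattened
   by entourages of Y, have as traces on X a base of a doubly stable filter; if
   it is equivalent to an intersection of Cauchy filters, then the set of the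
   limits in Y of these is a limit of the filter on P_0(Y). *)
Require Import Defs.
From mathcomp Require Import all_boot all_classical topology.

Set Implicit Arguments.
Unset Strict Implicit.
Unset Printing Implicit Defensive.

Local Open Scope classical_set_scope.
Local Open Scope relation_scope.

(** * Cauchy filters of the symmetrization and doubly stable filters *)

Lemma cauchy_square (T : uniformType) (F : set_system T) :
  ProperFilter F -> cauchy F -> forall E, entourage E ->
    exists2 A, F A & forall x y, A x -> A y -> E (x, y).
Proof.
move=> FF Fc E entE; have [[A B] /= [FA FB] ABE] := Fc _ entE.
by exists (A `&` B); [exact: filterI | move=> x y [Ax _] [_ By]; exact: ABE].
Qed.

Lemma square_cauchy (T : uniformType) (F : set_system T) :
  (forall E, entourage E ->
    exists2 A, F A & forall x y, A x -> A y -> E (x, y)) -> cauchy F.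
Proof.
move=> Fsq E /Fsq[A FA AE]; exists (A, A) => //= -[x y] /= [Ax Ay]; exact: AE.
Qed.

Lemma entourage_symmetrized (X : quasiUniformType) (U : set (X * X)) :
  qentourage U -> @entourage (symmetrized X) U.
Proof. by move=> entU; exists U => // ? []. Qed.

(** Together with the preceding lemma this lets later lemmas take an entourage [W] of the
    symmetrization and be applied to both [W] and [W^-1], one for each direction of a relation. *)
Lemma entourage_symmetrizedV (X : quasiUniformType) (U : set (X * X)) :
  qentourage U -> @entourage (symmetrized X) U^-1.
Proof. by move=> entU; exists U => // ? []. Qed.

Lemma cauchy_intersection_proper (X : quasiUniformType) (G : set_system X) :
  cauchy_intersection G -> ProperFilter G.
Proof.
move=> [C [[H CH] Cc ->]]; split=> [C0|].
  by have [HP _] := Cc _ CH; apply: (@filter_not_empty _ H); exact: C0.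
split=> [K CK|A B CA CB K CK|A B AB CA K CK]; have [KP _] := Cc _ CK.
- exact: filterT.
- by apply: filterI; [exact: CA | exact: CB].
- exact: filterS AB (CA _ CK).
Qed.

(** Each filter [H] of the family contains a [U]-small set [B]. A set of [G] belongs to [H], so it
    meets [B], and every point of [B] is then [U]-related in both directions to a point of it. *)
Lemma cauchy_intersection_doubly_stable (X : quasiUniformType)
  (G : set_system X) : cauchy_intersection G -> doubly_stable G.
Proof.
move=> [C [_ Cc ->]] U /entourage_symmetrized entU H CH.
have [HP Hc] := Cc _ CH.
have [B HB BU] := cauchy_square HP Hc entU.
apply: (filterS _ HB) => x Bx A GA.
have [y [Ay By]] := filter_ex (filterI (GA _ CH) HB).
by split; apply/ent_imageP; exists y => //; exact: BU.
Qed.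

Definition ds_of_cauchy_intersection (X : quasiUniformType)
    (G : set_system X) (Gc : cauchy_intersection G) : ds_filter X :=
  DsFilter (cauchy_intersection_proper Gc)
    (cauchy_intersection_doubly_stable Gc).

Lemma ds_equivalentP (X : quasiUniformType) (F G : ds_filter X) :
  ds_equivalent F G <->
  forall U, qentourage U -> ds_ent U (F, G) /\ ds_ent U (G, F).
Proof.
split=> [[FG GF] U entU|FG].
  by split; [apply: FG | apply: GF]; exists U.
by split=> W [U /FG[FGU GFU] UW]; exact: UW.
Qed.

(** * Approximation and limits in the bicompletion *)

Lemma bicompletion_entourage (X Y : quasiUniformType) (i : X -> Y) :
  is_bicompletion i -> forall V, qentourage V ->
  @qentourage X [set xy | V (i xy.1, i xy.2)].
Proof. by move=> bic V entV; rewrite (bicompletion_qentourage bic); exists V. Qed.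

Lemma bicompletion_entourageP (X Y : quasiUniformType) (i : X -> Y) :
  is_bicompletion i -> forall U, @qentourage X U ->
  exists2 V, qentourage V & forall x y, V (i x, i y) -> U (x, y).
Proof.
move=> bic U; rewrite (bicompletion_qentourage bic) => -[V entV VU].
by exists V => // x y Vxy; exact: VU.
Qed.

Lemma bicompletion_approx (X Y : quasiUniformType) (i : X -> Y) :
  is_bicompletion i -> forall (E : set (Y * Y)) (y : Y),
  @entourage (symmetrized Y) E -> exists x, E (y, i x).
Proof.
move=> bic E y entE.
have nE : @nbhs _ (symmetrized Y) y (xsection E y).
  by rewrite -nbhs_entourageE; exists E.
(* Density speaks of open sets, whereas the section of [E] is just a neighborhood of [y]. *)
have y0 : (@interior (symmetrized Y) (xsection E y)) !=set0 by exists y.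
have [z [zE [x _ xz]]] :=
  bicompletion_dense bic y0 (@open_interior (symmetrized Y) _).
by exists x; apply/xsectionP; rewrite xz; exact: interior_subset zE.
Qed.

(** Entourages of [Y] pull back to entourages of [X], so the image of [H] under [i] is Cauchy and
    bicompleteness of [Y] provides the limit. *)
Lemma bicompletion_cvg (X Y : quasiUniformType) (i : X -> Y) :
  is_bicompletion i -> forall H : set_system (symmetrized X),
  ProperFilter H -> cauchy H ->
  exists c : Y, forall E, @entourage (symmetrized Y) E ->
    H [set x | E (c, i x)].
Proof.
move=> bic H HP Hc.
pose K : set_system (symmetrized Y) := fmap (i : symmetrized X -> _) H.
have KP : ProperFilter K by exact: fmap_proper_filter.
have [] := bicompletion_bicomplete bic KP.
  apply: square_cauchy => E [V entV VE].
  have [A HA AV] := cauchy_square HP Hc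
    (entourage_symmetrized (bicompletion_entourage bic entV)).
  exists (i @` A).
    by apply: (@filterS _ H _ A) HA => x Ax; exists x.
  move=> _ _ [x Ax <-] [y Ay <-]; apply: VE.
  by split; [exact: (AV x y) | exact: (AV y x)].
by move=> c /cvg_entourageP Kc; exists c => E /Kc.
Qed.

Definition nbhs_trace (X Y : quasiUniformType) (i : X -> Y) (c : Y) :
    set_system (symmetrized X) :=
  filter_from (@entourage (symmetrized Y)) (fun E => [set x | E (c, i x)]).

Lemma nbhs_trace_proper (X Y : quasiUniformType) (i : X -> Y) (c : Y) :
  is_bicompletion i -> ProperFilter (nbhs_trace i c).
Proof.
move=> bic; apply: filter_from_proper; last first.
  by move=> E entE; exact: bicompletion_approx.
apply: filter_from_filter; first by exists setT; exact: filterT.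
by move=> E D entE entD; exists (E `&` D) => //; exact: filterI.
Qed.

Lemma nbhs_trace_cauchy (X Y : quasiUniformType) (i : X -> Y) (c : Y) :
  is_bicompletion i -> cauchy (nbhs_trace i c).
Proof.
move=> bic; apply: square_cauchy => E [U entU UE].
have [V entV VU] := bicompletion_entourageP bic entU.
have [W entW WV] := qentourage_split_ex _ entV.
(* Points near [c] in both directions are joined through [c] in either order. *)
exists [set x | (W `&` W^-1) (c, i x)].
  by exists (W `&` W^-1) => //; exists W.
move=> x y [? ?] [? ?]; apply: UE; split; apply: VU; apply: WV;
  by exists c.
Qed.

(** * From bicompleteness of the hyperspace to intersections of Cauchy filters *)

Lemma hausdorff_cvgP (Y : quasiUniformType)
    (A : set_system (symmetrized (hyperspace Y))) (C : hyperspace Y) :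
  Filter A ->
  (A --> (C : symmetrized (hyperspace Y))) <->
  forall V, qentourage V ->
    A [set B | hausdorff_ent V (C, B) /\ hausdorff_ent V (B, C)].
Proof.
move=> FA; split=> [/cvg_entourageP Acv V entV|Acv].
  apply: (Acv [set BD | hausdorff_ent V BD /\ hausdorff_ent V (BD.2, BD.1)]).
  by exists (hausdorff_ent V); [exists V | move=> [B D] []].
apply/cvg_entourageP => E [W [V entV VW] WE].
by apply: filterS (Acv _ entV) => B [CB BC]; apply: WE; split; exact: VW.
Qed.

(* Both halves of [ds_ent U (F, G)], and, with [U^-1] and [W^-1] in place of
   [U] and [W], both halves of [ds_ent U (G, F)]. *)
Lemma ds_ent_nbhs_trace (X Y : quasiUniformType) (i : X -> Y)
    (U : set (X * X)) (W : set (Y * Y)) (F : set_system X) (A0 : set X)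
    (C : set Y) :
  is_bicompletion i -> Filter F -> @entourage (symmetrized Y) W ->
  (forall x y, (W \; W) (i x, i y) -> U (x, y)) ->
  F A0 ->
  (forall B, F B -> B `<=` A0 ->
     C `<=` ent_image W (i @` B) /\ i @` B `<=` ent_image W^-1 C) ->
  let G : set_system X := \bigcap_(c in C) nbhs_trace i c in
  G (\bigcap_(A in F) ent_image U A) /\
  F (\bigcap_(B in G) ent_image U^-1 B).
Proof.
move=> bic FF entW WU FA0 A0C G; split.
  move=> c Cc; exists W => // x /= Wcx A FA.
  (* Shrinking [A] to its intersection with [A0] makes the hypothesis apply; the chain is [i a],
     [c], [i x]. *)
  have [AC _] := A0C _ (filterI FA FA0) (@subIsetr _ _ _).
  have /ent_imageP[_ [a [Aa _] <-] Wac] := AC _ Cc.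
  by apply/ent_imageP; exists a => //; apply: WU; exists c.
apply: (filterS _ FA0) => x A0x B GB.
have [_ A0W] := A0C _ FA0 (@subset_refl _ _).
have /ent_imageP[c Cc Wxc] : ent_image W^-1 C (i x) by apply: A0W; exists x.
have [E entE EB] := GB _ Cc.
(* The factor [E] puts [y] into [B], the factor [W] links it to [x] through [c]. *)
have [y [Ecy Wcy]] := bicompletion_approx bic c (filterI entE entW).
by apply/ent_imageP; exists y; [exact: EB | apply: WU; exists c].
Qed.

Lemma ds_equivalent_of_hyper_bicomplete (X Y : quasiUniformType) (i : X -> Y) :
  is_bicompletion i -> bicomplete (hyperspace Y) -> forall F : ds_filter X,
  exists G : ds_filter X, cauchy_intersection G /\ ds_equivalent F G.
Proof.
move=> bic bicH F.
pose base A := [set K : hyperspace Y |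
  exists B, [/\ ds_sets F B, B `<=` A & hyper_set K = i @` B]].
pose A : set_system (symmetrized (hyperspace Y)) := filter_from (ds_sets F) base.
have AP : ProperFilter A.
  apply: filter_from_proper.
    apply: filter_from_filter; first by exists setT; exact: filterT.
    move=> S T FS FT; exists (S `&` T); first exact: filterI.
    by move=> K [B [FB BST KB]]; split; exists B; split=> // x /BST[].
  move=> S FS; have [x Sx] := filter_ex FS.
  have S0 : (i @` S) !=set0 by exists (i x); exists x.
  by exists (Hyperspace S0), S; split=> //; exact: subset_refl.
have Ac : cauchy A.
  apply: square_cauchy => E [W [V entV VW] WE].
  (* Each point of [S] is [V]-related in both directions to some point of every set of [F], so the
     images of any two sets of [F] inside [S] are close for [hausdorff_ent V]. *)
  have FS := ds_doubly_stable F (bicompletion_entourage bic entV).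
  set S := \bigcap_(_ in _) _ in FS.
  exists (base S); first by exists S.
  have sq K L : base S K -> base S L -> hausdorff_ent V (K, L).
    move=> [B [FB BS KB]] [D [FD DS LD]]; split=> /=; rewrite KB LD.
      move=> _ [x Dx <-]; have [_ /ent_imageP[y By Vyx]] := DS _ Dx _ FB.
      by apply/ent_imageP; exists (i y) => //; exists y.
    move=> _ [x Bx <-]; have [/ent_imageP[y Dy Vyx] _] := BS _ Bx _ FD.
    by apply/ent_imageP; exists (i y) => //; exists y.
  by move=> K L SK SL; apply: WE; split; apply: VW; exact: sq.
have [C /hausdorff_cvgP Acv] := bicH _ AP Ac.
have Gc : cauchy_intersection
    (\bigcap_(c in hyper_set C) nbhs_trace i c : set_system X).
  exists (nbhs_trace i @` C); split.
  - by have [c Cc] := hyper_set_neq0 C; exists (nbhs_trace i c); exists c.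
  - move=> _ [c _ <-].
    by split; [exact: nbhs_trace_proper | exact: nbhs_trace_cauchy].
  - by rewrite bigcap_image.
exists (ds_of_cauchy_intersection Gc); split=> //.
apply/ds_equivalentP => U entU.
have [V entV VU] := bicompletion_entourageP bic entU.
have [W entW WV] := qentourage_split_ex _ entV.
have [A0 FA0 A0W] := Acv _ entW.
have A0C B : ds_sets F B -> B `<=` A0 ->
    (hyper_set C `<=` ent_image W (i @` B) /\ i @` B `<=` ent_image W^-1 C) /\
    (hyper_set C `<=` ent_image W^-1 (i @` B) /\ i @` B `<=` ent_image W C).
  move=> FB BA0; have [x Bx] := filter_ex FB.
  have B0 : (i @` B) !=set0 by exists (i x); exists x.
  have [|[]] := A0W (Hyperspace B0); first by exists B.
  by move=> /= ? ? [].
split.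
  apply: (ds_ent_nbhs_trace bic _ (entourage_symmetrized entW)) FA0 _ => //.
  - by move=> x y /WV /VU.
  - by move=> B FB /(A0C _ FB)[].
have [||GF FG] := @ds_ent_nbhs_trace _ _ _ U^-1 W^-1 F A0 C bic _
  (entourage_symmetrizedV entW) _ FA0 _; last by split.
- by move=> x y [z ? ?]; apply: VU; apply: WV; exists z.
- by move=> B FB /(A0C _ FB)[].
Qed.

(** * From intersections of Cauchy filters to bicompleteness of the hyperspace *)

(* The union of the members of [S] may miss [i(X)]; its fattening by [E] does
   not, by density. *)
Definition hyper_trace (X Y : quasiUniformType) (i : X -> Y)
    (A : set_system (hyperspace Y)) : set_system X :=
  filter_from
    [set ES : set (Y * Y) * set (hyperspace Y) |
      @entourage (symmetrized Y) ES.1 /\ A ES.2]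
    (fun ES => [set x | exists2 K : hyperspace Y, ES.2 K &
       ent_image ES.1 K (i x)]).

Lemma hyper_trace_proper (X Y : quasiUniformType) (i : X -> Y)
    (A : set_system (hyperspace Y)) :
  is_bicompletion i -> ProperFilter A -> ProperFilter (hyper_trace i A).
Proof.
move=> bic AP; apply: filter_from_proper.
  apply: filter_from_filter; first exists (setT, setT).
    split; last exact: filterT.
    exact: (@filterT _ (@entourage (symmetrized Y))).
  move=> [E S] [D T] [/= entE AS] [/= entD AT].
  exists (E `&` D, S `&` T); first (split; last exact: filterI).
    exact: (@filterI _ (@entourage (symmetrized Y))).
  move=> x [K [SK TK] Kx].
  by split; exists K => //; apply: ent_imageS Kx => // ? [].
move=> [E S] [/= entE AS].
have [K SK] := filter_ex AS; have [y Ky] := hyper_set_neq0 K.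
have [x Eyx] := bicompletion_approx bic y entE.
by exists x; exists K => //; apply/ent_imageP; exists y.
Qed.

(** Some [L] lies both in [S] and in the set [R] of a base set inside [T]. The first link goes from
    [a] to a point [b] of [L]; the second goes, by density, from [b] to an [i x] that is also
    [E]-close to [b], which puts [x] in [T]. *)
Lemma hyper_trace_approx (X Y : quasiUniformType) (i : X -> Y)
    (A : set_system (hyperspace Y)) (W : set (Y * Y))
    (S : set (hyperspace Y)) (T : set X) (K : hyperspace Y) (a : Y) :
  is_bicompletion i -> ProperFilter A -> @entourage (symmetrized Y) W ->
  A S -> (forall L, S L -> hyper_set K `<=` ent_image W L) ->
  hyper_trace i A T -> hyper_set K a ->
  exists2 x, T x & (W^-1 \; W^-1) (a, i x).
Proof.
move=> bic AP entW AS SW [[E R] [/= entE AR] RT] Ka.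
have [L [SL RL]] := filter_ex (filterI AS AR).
have /ent_imageP[b Lb Wba] := SW _ SL _ Ka.
have entWV : @entourage (symmetrized Y) W^-1 by exact: entourage_inv.
have [x [Ebx Wxb]] := bicompletion_approx bic b
  (@filterI _ (@entourage (symmetrized Y)) _ _ _ entE entWV).
exists x; last by exists b.
by apply: RT; exists L => //; apply/ent_imageP; exists b.
Qed.

(** Four is the length of the chains in [hausdorff_ent_hyper_trace] that lead from a point of [K] to
    a limit in [C]. *)
Lemma qentourage_split4 (Y : quasiUniformType) (V : set (Y * Y)) :
  qentourage V -> exists2 W, qentourage W & (W \; W) \; (W \; W) `<=` V.
Proof.
move=> entV; have [Z entZ ZV] := qentourage_split_ex _ entV.
have [W entW WZ] := qentourage_split_ex _ entZ.
by exists W => // xy [z Wxz Wzy]; apply: ZV; exists z; exact: WZ.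
Qed.

Lemma hyper_trace_doubly_stable (X Y : quasiUniformType) (i : X -> Y)
    (A : set_system (symmetrized (hyperspace Y))) :
  is_bicompletion i -> ProperFilter A -> cauchy A ->
  doubly_stable (hyper_trace i A).
Proof.
move=> bic AP Ac U /(bicompletion_entourageP bic)[V entV VU].
have [W entW WV] := qentourage_split4 entV.
(* The chains of this proof have three links, [i x], [a], [b], [i y], read in either direction;
   reflexivity pads them to four. *)
have Wxx y : W (y, y) by apply: (qentourage_diagonal _ entW); exact/diagonalP.
have entWs := entourage_symmetrized entW.
have entWVs := entourage_symmetrizedV entW.
have [S AS SW] : exists2 S, A S &
    forall K L, S K -> S L -> hausdorff_ent W (K, L).
  apply: (cauchy_square AP Ac (E := hausdorff_ent W)).
  by apply: entourage_symmetrized; exists W.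
(* Fattening by a symmetric entourage links [i x] to [a] in both directions, one for each half of
   double stability. *)
exists (W `&` W^-1, S); first by split=> //; exists W.
move=> x [K SK /ent_imageP[a Ka [Wax Wxa]]] T FT; split; apply/ent_imageP.
  have [|y Ty [b Wab Wby]] :=
    hyper_trace_approx bic AP entWVs AS (K := K) _ FT Ka.
    by move=> L SL; have [_] := SW _ _ SK SL.
  exists y => //; apply: VU; apply: WV; exists a; first by exists (i x).
  by exists b.
have [|y Ty [b Wba Wyb]] :=
  hyper_trace_approx bic AP entWs AS (K := K) _ FT Ka.
  by move=> L SL; have [] := SW _ _ SL SK.
exists y => //; apply: VU; apply: WV; exists a; first by exists b.
by exists (i x).
Qed.

(* With [U^-1], [V^-1] and [W^-1] in place of [U], [V] and [W] this also gives
   the relation between [K] and [C] in the opposite order. *)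
Lemma hausdorff_ent_hyper_trace (X Y : quasiUniformType) (i : X -> Y)
    (A : set_system (hyperspace Y)) (V W : set (Y * Y))
    (S : set (hyperspace Y)) (K : hyperspace Y)
    (D : set (set_system (symmetrized X))) (C : set Y) :
  is_bicompletion i -> ProperFilter A -> @entourage (symmetrized Y) W ->
  (W \; W) \; (W \; W) `<=` V ->
  A S -> S K ->
  (forall L, S L -> hyper_set L `<=` ent_image W K /\
                    hyper_set K `<=` ent_image W^-1 L) ->
  (forall H, D H -> ProperFilter H) ->
  (forall c, C c -> exists2 H, D H &
     forall E, @entourage (symmetrized Y) E -> H [set x | E (c, i x)]) ->
  (forall H, D H -> exists2 c, C c &
     forall E, @entourage (symmetrized Y) E -> H [set x | E (c, i x)]) ->
  let F := hyper_trace i A in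
  let G := \bigcap_(H in D) H : set_system X in
  let U := [set xy | W (i xy.1, i xy.2)] in
  G (\bigcap_(T in F) ent_image U T) ->
  F (\bigcap_(B in G) ent_image U^-1 B) ->
  C `<=` ent_image V K /\ hyper_set K `<=` ent_image V^-1 C.
Proof.
move=> bic AP entW WV AS SK SW DP CD DC F G U GF FG.
have entWV : @entourage (symmetrized Y) W^-1 by exact: entourage_inv.
split.
  (* The chain is [a], [b], [i y], [i x], [c]: its links come from the smallness of [S], the
     fattening, [GF], and the convergence of [H] to [c]. *)
  move=> c /CD[H DH Hc]; have HP := DP _ DH.
  have [x [Tx Wxc]] := filter_ex (filterI (GF _ DH) (Hc _ entWV)).
  have FT : F [set x | exists2 L : hyperspace Y, S L & ent_image W L (i x)].
    by exists (W, S).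
  have /ent_imageP[y [L SL /ent_imageP[b Lb Wby]] Wyx] := Tx _ FT.
  have [/(_ _ Lb)/ent_imageP[a Ka Wab] _] := SW _ SL.
  apply/ent_imageP; exists a => //; apply: WV.
  by exists (i y); [exists b | exists (i x)].
move=> a Ka.
(* The chain is [a], [b], [i y], [i z], [c]; the point [y] is taken in the set provided by [FG],
   hence is linked to every set of [G], in particular to the points close to [C]. *)
have [|y Ty [b Wab Wby]] := hyper_trace_approx bic AP entWV AS (K := K) _ FG Ka.
  by move=> L /SW[].
have GB : G [set x | exists2 c, C c & W (i x, c)].
  move=> H DH; have HP := DP _ DH; have [c Cc Hc] := DC _ DH.
  by apply: filterS (Hc _ entWV) => x Wxc; exists c.
have /ent_imageP[z [c Cc Wzc] Wyz] := Ty _ GB.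
apply/ent_imageP; exists c => //; apply: WV.
by exists (i y); [exists b | exists (i z)].
Qed.

Lemma hyper_bicomplete_of_ds_equivalent (X Y : quasiUniformType) (i : X -> Y) :
  is_bicompletion i ->
  (forall F : ds_filter X,
    exists G : ds_filter X, cauchy_intersection G /\ ds_equivalent F G) ->
  bicomplete (hyperspace Y).
Proof.
move=> bic dsX A AP Ac.
pose F := DsFilter (hyper_trace_proper bic AP)
  (hyper_trace_doubly_stable bic AP Ac).
have [G [[D [[H0 DH0] Dc GD]] /ds_equivalentP FG]] := dsX F.
pose lim (H : set_system (symmetrized X)) c :=
  forall E, @entourage (symmetrized Y) E -> H [set x | E (c, i x)].
have Dlim H : D H -> exists c, lim H c.
  by move=> /Dc[HP Hc]; exact: bicompletion_cvg.
(* Taking every limit of every filter in [D] avoids choosing one for each. *)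
pose C := [set c | exists2 H, D H & lim H c].
have C0 : C !=set0 by have [c Hc] := Dlim _ DH0; exists c, H0.
have DP H : D H -> ProperFilter H by move=> /Dc[].
have DC H : D H -> exists2 c, C c & lim H c.
  by move=> DH; have [c Hc] := Dlim _ DH; exists c => //; exists H.
exists (Hyperspace C0); apply/hausdorff_cvgP => V entV.
have [W entW WV] := qentourage_split4 entV.
have [S AS SW] : exists2 S, A S &
    forall K L, S K -> S L -> hausdorff_ent W (K, L).
  apply: (cauchy_square AP Ac (E := hausdorff_ent W)).
  by apply: entourage_symmetrized; exists W.
have [[/= GFW FGW] [/= FGWV GFWV]] := FG _ (bicompletion_entourage bic entW).
rewrite GD in GFW FGW FGWV GFWV.
apply: (filterS _ AS) => K SK.
have [CK KC] : C `<=` ent_image V K /\ hyper_set K `<=` ent_image V^-1 C.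
  apply: (hausdorff_ent_hyper_trace bic AP (entourage_symmetrized entW) WV AS
    SK _ DP _ DC GFW FGW) => //.
  by move=> L SL; have [] := SW _ _ SK SL.
have [KC' CK'] : C `<=` ent_image V^-1 K /\ hyper_set K `<=` ent_image V C.
  apply: (hausdorff_ent_hyper_trace bic AP (entourage_symmetrizedV entW) _ AS
    SK _ DP _ DC GFWV FGWV) => //.
    (* Reversing a four-link chain exchanges its two halves. *)
    by move=> [x y] [z [u ? ?] [v ? ?]]; apply: WV; exists z;
      [exists v | exists u].
  by move=> L SL; have [] := SW _ _ SL SK.
by split.
Qed.

Theorem proposition5 (X Xt : quasiUniformType) (i : X -> Xt)
    (X_T0 : kolmogorov_space X) (bicompl_i : is_bicompletion i) :
  bicomplete (hyperspace Xt) <->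
  forall F : ds_filter X,
    exists G : ds_filter X, cauchy_intersection G /\ ds_equivalent F G.
Proof.
split; first exact: ds_equivalent_of_hyper_bicomplete bicompl_i.
exact: hyper_bicomplete_of_ds_equivalent bicompl_i.
Qed.
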